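(* Let $X$ be a real Banach space with continuous dual $X^*$, and let $A,B\colon X\rightrightarrows X^*$ be maximal monotone operators with $\operatorname{dom} A\cap \operatorname{int}\operatorname{dom} B\neq\varnothing$. Assume that $A+N_{\overline{\operatorname{dom} B}}$ is maximal monotone of type (FPV), and that $\operatorname{dom} A\cap\overline{\operatorname{dom} B}\subseteq \operatorname{dom} B$. Then $A+B$ is maximal monotone.
   Context: $X$ is a real Banach space, $X^*$ its continuous dual, and $\langle x,x^*\rangle$ denotes the duality pairing. A set-valued operator $A\colon X\rightrightarrows X^*$ assigns to each $x\in X$ a subset $Ax\subseteq X^*$; its graph is $\operatorname{gra} A=\{(x,x^* )\in X\times X^*\mid x^*\in Ax\}$ and its domain is $\operatorname{dom} A=\{x\in X\mid Ax\neq\varnothing\}$. $A$ is monotone if $\langle x-y,x^*-y^*\rangle\geq 0$ for all $(x,x^* ),(y,y^* )\in\operatorname{gra} A$; it is maximal monotone if it is monotone and its graph is not properly contained in the graph of another monotone operator. The sum $A+B$ is defined by $(A+B)x=\{a^*+b^*\mid a^*\in Ax,\ b^*\in Bx\}$. $\operatorname{int}$ and the overline denote norm interior and norm closure in $X$. For $C\subseteq X$, the normal cone operator $N_C\colon X\rightrightarrows X^*$ is $N_C(x)=\{x^*\in X^*\mid \sup_{c\in C}\langle c-x,x^*\rangle\leq 0\}$ if $x\in C$, and $N_C(x)=\varnothing$ if $x\notin C$. A maximal monotone operator $A\colon X\rightrightarrows X^*$ is of type (FPV) if for every open convex set $U\subseteq X$ with $U\cap\operatorname{dom} A\neq\varnothing$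 the following holds: whenever $x\in U$ and $x^*\in X^*$ satisfy $\langle x-y,x^*-y^*\rangle\geq 0$ for all $(y,y^* )\in\operatorname{gra} A\cap (U\times X^* )$, then $(x,x^* )\in\operatorname{gra} A$. *)

(* Defs.v *)
From HB Require Import structures.
From mathcomp Require Import all_boot all_order all_algebra.
From mathcomp Require Import all_classical all_reals all_analysis.

Set Implicit Arguments.
Unset Strict Implicit.
Unset Printing Implicit Defensive.

Import Order.TTheory GRing.Theory Num.Theory.
Import numFieldNormedType.Exports.

Local Open Scope classical_set_scope.
Local Open Scope ring_scope.

Section Dual.
Context (R : realType) (X : normedModType R).

Definition is_dual (f : X -> R^o) : bool := `[< linear f /\ continuous f >].

Fact is_dual_submod_closed : submod_closed is_dual.
Proof.
split.
  apply/asboolP; split => [a x y|x]; last exact: cvg_cst.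
  by rewrite /GRing.zero/= scaler0 addr0.
move=> a f g /asboolP[lf cf] /asboolP[lg cg]; apply/asboolP; split.
  move=> b x y; rewrite !fctE lf lg !scalerDr !scalerA (mulrC a b).
  by rewrite addrACA.
by move=> x; apply: cvgD; [apply: cvgZl_tmp; exact: cf|exact: cg].
Qed.

HB.instance Definition _ :=
  GRing.isSubmodClosed.Build R (X -> R^o) is_dual is_dual_submod_closed.

(* The continuous dual; the pairing of [x : X] with [xs : dual] is [xs x]. *)
Record dual := Dual { dual_fun :> X -> R^o; _ : is_dual dual_fun }.

HB.instance Definition _ := [isSub for dual_fun].
HB.instance Definition _ := [Choice of dual by <:].
HB.instance Definition _ := [SubChoice_isSubLmodule of dual by <:].

End Dual.

Section Operators.
Context (R : realType) (X : normedModType R).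
Implicit Types (A B : X -> set (dual X)) (C : set X).

Definition gra A : set (X * dual X) := [set p | A p.1 p.2].

Definition dom A : set X := [set x | A x !=set0].

Definition monotone_op A : Prop :=
  forall p q, gra A p -> gra A q -> 0 <= (p.2 - q.2) (p.1 - q.1).

Definition maximal_monotone A : Prop :=
  monotone_op A /\ ~ exists B, monotone_op B /\ gra A `<` gra B.

Definition sum_op A B : X -> set (dual X) :=
  fun x => [set a + b | a in A x & b in B x].

Definition normal_cone C : X -> set (dual X) :=
  fun x => [set xs | C x /\
    (ereal_sup [set (xs (c - x))%:E | c in C] <= 0)%E].

(* [convex_lmodType X] is [X] itself, carrying the convex combinations of its
   module structure. *)
Definition type_FPV A : Prop :=
  maximal_monotone A /\
  forall U : set X, open U -> convex_set (U : set (convex_lmodType X)) ->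
    U `&` dom A !=set0 ->
    forall (x : X) (xs : dual X), U x ->
      (forall p, (gra A `&` (U `*` setT)) p -> 0 <= (xs - p.2) (x - p.1)) ->
      gra A (x, xs).

End Operators.

(* Main.v *)
From HB Require Import structures.
Require Import Defs.
From mathcomp Require Import all_boot all_order all_algebra.
From mathcomp Require Import all_classical all_reals all_analysis.
From mathcomp Require Import lra ring.

(** Write C for the closure of dom B and T = A + N_C; maximality of B makes B
    absorb N_C, so it suffices to study T + B. Type (FPV) of T, applied on thin
    tubes around segments from z to x0 (where B cannot push away from z faster
    than linearly), shows that no pair (z, z* ) is uniformly strictly
    monotonically related to T + B: the infimum of <z - x, z* - w> over the
    graph of T + B is at most 0, i.e. the Fitzpatrick function of the sum
    dominates the pairing. For (z, z* ) monotonically related to A + B this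
    makes a convex set built from the Fitzpatrick functions of A and B
    separable by a functional w*, and maximality gives w* in A z and z* - w* in
    B z. *)

Set Implicit Arguments.
Unset Strict Implicit.
Unset Printing Implicit Defensive.

Import Order.TTheory GRing.Theory Num.Theory.
Import numFieldNormedType.Exports.

Local Open Scope classical_set_scope.
Local Open Scope ring_scope.

(** * The duality pairing and boundedness of functionals *)

Section Pairing.
Context (R : realType) (X : normedModType R).
Implicit Types (x y : X) (f g : dual X).

Definition pairing x f : R := f x.
Local Notation "⟨ x , f ⟩" := (pairing x f).

Lemma dual_linear f : linear f.
Proof. by have /asboolP[] := valP f. Qed.

Lemma pairingDl x y f : ⟨x + y, f⟩ = ⟨x, f⟩ + ⟨y, f⟩.
Proof. by have := dual_linear f 1 x y; rewrite !scale1r. Qed.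

Lemma pairing0l f : ⟨0, f⟩ = 0.
Proof. by apply: (addrI ⟨0, f⟩); rewrite -pairingDl !addr0. Qed.

Lemma pairingZl c x f : ⟨c *: x, f⟩ = c * ⟨x, f⟩.
Proof.
have := dual_linear f c x 0; rewrite /= !addr0 => /= e.
by rewrite /pairing e -[X in _ + X]/⟨0, f⟩ pairing0l addr0.
Qed.

Lemma pairingNl x f : ⟨- x, f⟩ = - ⟨x, f⟩.
Proof. by rewrite -scaleN1r pairingZl mulN1r. Qed.

Lemma pairingDr x f g : ⟨x, f + g⟩ = ⟨x, f⟩ + ⟨x, g⟩.
Proof. by []. Qed.

Lemma pairingNr x f : ⟨x, - f⟩ = - ⟨x, f⟩.
Proof. by []. Qed.

Lemma pairingZr c x f : ⟨x, c *: f⟩ = c * ⟨x, f⟩.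
Proof. by []. Qed.

Definition pairingE :=
  (pairingDl, pairingNl, pairingZl, pairing0l, pairingDr, pairingNr, pairingZr).

Let pack_linear (f : X -> R^o) (lf : linear f) : {linear X -> R^o} :=
  HB.pack f (GRing.isLinear.Build _ _ _ _ _ lf).

Lemma dual_bounded f : exists2 M, 0 < M & forall x, `|⟨x, f⟩| <= M * `|x|.
Proof.
have /asboolP[lf cf] := valP f.
have /linear_bounded_continuous/linear_boundedP := cf : continuous (pack_linear lf).
by move=> /pinfty_ex_gt0 [M M0 Mf]; exists M.
Qed.

Lemma dual_of_bounded (f : X -> R) (M : R) : linear (f : X -> R^o) ->
  (forall x, `|f x| <= M * `|x|) ->
  exists g : dual X, forall x, ⟨x, g⟩ = f x.
Proof.
move=> lf fM.
suff df : is_dual (f : X -> R^o) by exists (Dual df).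
apply/asboolP; split => //.
apply: (@bounded_linear_continuous _ _ _ (pack_linear lf)).
apply/linear_boundedP; exists M; split; first by rewrite num_real.
move=> r Mr x; apply: (le_trans (fM x)).
by apply: ler_wpM2r => //; exact: ltW.
Qed.

End Pairing.

Notation "⟨ x , f ⟩" := (pairing x f).
Arguments pairing : simpl never.

(** * Hahn-Banach for convex cones, via Zorn's lemma *)

Section HahnBanach.
Context (R : realType) (X : normedModType R).
Implicit Types (S : set (X * R)).

(** Coefficients are strictly positive, so a cone need not contain the origin. *)
Definition cone_set S := forall u v s t a b, S (u, s) -> S (v, t) ->
  0 < a -> 0 < b -> S (a *: u + b *: v, a * s + b * t).

Definition nonneg_fiber S := forall t, S (0, t) -> 0 <= t.

(* A maximal such cone contains the graph of the functional
   [v |-> inf {t | (v, t) in S}]. *)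
Lemma maximal_cone S : S !=set0 -> cone_set S -> nonneg_fiber S ->
  exists T, [/\ S `<=` T, cone_set T, nonneg_fiber T &
    forall T', T `<=` T' -> cone_set T' -> nonneg_fiber T' -> T' `<=` T].
Proof.
move=> S0 Sc Sn.
pose P T := T = set0 \/ [/\ S `<=` T, cone_set T & nonneg_fiber T].
have [|T [PT Tmax]] := @Zorn_bigcup _ P.
  move=> F FP Ft.
  have [F0|/existsNP[T0 /not_implyP[FT0 T00]]] := pselect (forall T, F T -> T = set0).
    by left; rewrite -subset0 => x [T /F0 ->].
  right; split.
  - have [//|[ST0 _ _]] := FP _ FT0.
    by move=> x /ST0 T0x; exists T0.
  - move=> u v s t a b [T1 FT1 T1u] [T2 FT2 T2v] a0 b0.
    have [T12|T21] := Ft _ _ FT1 FT2.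
    + exists T2 => //; have [T2E|[_ c _]] := FP _ FT2.
        by move: T2v; rewrite T2E.
      by apply: c => //; exact: T12.
    + exists T1 => //; have [T1E|[_ c _]] := FP _ FT1.
        by move: T1u; rewrite T1E.
      by apply: c => //; exact: T21.
  - move=> t [T1 FT1 T1t]; have [T1E|[_ _ n]] := FP _ FT1; last exact: n.
    by move: T1t; rewrite T1E.
case: PT => [T0|[ST Tc Tn]].
  exfalso; apply: (Tmax S); last by right; split.
  rewrite T0; split; first exact: sub0set.
  by move=> S0'; case: S0 => x /S0'.
exists T; split => // T' TT' T'c T'n x T'x.
apply: contrapT => Tx; apply: (Tmax T'); last first.
  by right; split => //; exact: subset_trans TT'.
by split => // /(_ x T'x).
Qed.

(** No new ray can be adjoined to a maximal cone [T]; this forces [w v], the infimum of the fibre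
    over [v], to be attained and odd, hence linear. The ball at height [M], with nonnegativity over
    0, makes it finite and bounded. *)
Lemma hahn_banach_cone S (r M : R) : cone_set S -> nonneg_fiber S -> 0 < r ->
  (forall v, `|v| <= r -> S (v, M)) ->
  exists f : dual X, forall v t, S (v, t) -> ⟨v, f⟩ <= t.
Proof.
move=> Sc Sn r0 SM.
have S0 : S !=set0 by exists (0, M); apply: SM; rewrite normr0 ltW.
have M0 : 0 <= M by apply: Sn; apply: SM; rewrite normr0 ltW.
have [T [ST Tc Tn Tmax]] := maximal_cone S0 Sc Sn.
have TZ c v t : 0 < c -> T (v, t) -> T (c *: v, c * t).
  move=> c0 Tv; have c2 : 0 < c / 2 by rewrite divr_gt0.
  have := Tc _ _ _ _ _ _ Tv Tv c2 c2.
  by rewrite -scalerDl -(mulrDl _ _ t) -splitr.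
have TD u v s t : T (u, s) -> T (v, t) -> T (u + v, s + t).
  by move=> Tu Tv; have := Tc _ _ _ _ _ _ Tu Tv ltr01 ltr01; rewrite !scale1r !mul1r.
have TM v : T (v, r^-1 * `|v| * M).
  have [->|v0] := eqVneq v 0.
    rewrite normr0 mulr0 mul0r.
    (* Adjoining the origin keeps [T] a cone with nonnegative fibre, so by maximality it already
       lies in [T]. *)
    pose T' := T `|` [set (0, 0)].
    apply: (Tmax T'); [by move=> x; left| | |by right].
    - move=> u w s t a b [Tu|[-> ->]] [Tw|[-> ->]] a0 b0.
      + by left; exact: Tc.
      + by left; rewrite scaler0 mulr0 !addr0; exact: TZ.
      + by left; rewrite scaler0 mulr0 !add0r; exact: TZ.
      + by right; rewrite !scaler0 !mulr0 !addr0.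
    - by move=> t [/Tn//|[->]].
  have v0' : 0 < `|v| by rewrite normr_gt0.
  have c0 : 0 < r^-1 * `|v| by rewrite mulr_gt0 ?invr_gt0.
  rewrite -[X in T (X, _)](scalerKV (lt0r_neq0 c0)).
  apply: TZ => //; apply: ST; apply: SM.
  rewrite normrZ gtr0_norm ?invr_gt0// invfM invrK -mulrA mulVf ?mulr1//.
  exact: lt0r_neq0.
have Tinf v : has_inf [set t | T (v, t)].
  split; first by exists (r^-1 * `|v| * M); exact: TM.
  exists (- (r^-1 * `|- v| * M)) => t /= Tv.
  by rewrite lerNl -subr_ge0 opprK addrC; apply: Tn; rewrite -(subrr v); exact: TD.
pose w v := inf [set t | T (v, t)].
have w_le v t : T (v, t) -> w v <= t.
  by move=> Tv; apply: ge_inf => //; exact: (Tinf v).2.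
have TN v : T (- v, - w v).
  (* Adjoins the ray through [(- v, - w v)]. Over 0 a new point has [u = c *: v], and then
     [c * w v <= s] because [w v] is an infimum. *)
  pose T' := [set p | T p] `|` [set p | exists c u s, [/\ 0 < c, T (u, s) &
     p = (u - c *: v, s - c * w v)]].
  have T0 : T (0, 0) by have := TM 0; rewrite normr0 mulr0 mul0r.
  apply: (Tmax T').
  - by move=> x; left.
  - move=> u1 u2 s t a b [Tu|[c [u [s' [c0 Tu [-> ->]]]]]]
      [Tw|[d [u' [t' [d0 Tu' [-> ->]]]]]] a0 b0.
    + by left; exact: Tc.
    + right; exists (b * d), (a *: u1 + b *: u'), (a * s + b * t').
      split; [exact: mulr_gt0|exact: Tc|].
      by rewrite !scalerBr !mulrBr !scalerA !addrA mulrA.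
    + right; exists (a * c), (a *: u + b *: u2), (a * s' + b * t).
      split; [exact: mulr_gt0|exact: Tc|].
      by rewrite !scalerBr !mulrBr !scalerA mulrA; congr (_, _); rewrite addrAC.
    + right; exists (a * c + b * d), (a *: u + b *: u'), (a * s' + b * t').
      split; [by rewrite addr_gt0 ?mulr_gt0|exact: Tc|].
      congr (_, _); last by ring.
      by rewrite !scalerBr !scalerA scalerDl opprD addrACA.
  - move=> t [/Tn//|[c [u [s [c0 Tu [e ->]]]]]].
    rewrite subr_ge0 -ler_pdivlMl//; apply: w_le.
    have /eqP -> : v == c^-1 *: u.
      by rewrite -[v](scalerK (lt0r_neq0 c0)) (eqP (_ : u == c *: v)) // -subr_eq0 -e.
    by apply: TZ => //; rewrite invr_gt0.
  - by right; exists 1, 0, 0; split => //; rewrite scale1r mul1r !sub0r.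
have wN v : w (- v) = - w v.
  apply/eqP; rewrite eq_le w_le//=; apply: lb_le_inf; first exact: (Tinf _).1.
  move=> s /= Ts; rewrite lerNl; apply: lb_le_inf; first exact: (Tinf _).1.
  move=> t /= Tt; rewrite lerNl -subr_ge0 opprK; apply: Tn.
  by rewrite -(addNr v); exact: TD.
have Tw v : T (v, w v) by have := TN (- v); rewrite wN !opprK.
have TwZ c v : T (c *: v, c * w v).
  have [c0|c0|->] := ltgtP c 0.
  - have c0' : 0 < - c by rewrite oppr_gt0.
    by have := TZ _ _ _ c0' (Tw (- v)); rewrite wN scalerN scaleNr opprK mulrN mulNr opprK.
  - exact: TZ.
  - by have := TM 0; rewrite scale0r normr0 mulr0 !mul0r.
have wl : linear (w : X -> R^o).
  move=> c u v; apply/eqP; rewrite eq_le; apply/andP; split.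
    by apply: w_le; apply: TD => //; exact: TwZ.
  rewrite -lerN2 -wN; apply: w_le.
  rewrite !opprD; apply: TD; last by rewrite -wN; exact: Tw.
  by have := TwZ (- c) u; rewrite scaleNr mulNr.
have [|f fw] := @dual_of_bounded _ _ w (r^-1 * M) wl.
  move=> v; rewrite ler_norml lerNl -wN.
  have h u : w u <= r^-1 * M * `|u| by rewrite mulrAC; exact/w_le/TM.
  by rewrite -{1}(normrN v) !h.
by exists f => v t Svt; rewrite fw; apply: w_le; exact: ST.
Qed.

End HahnBanach.

(** * Separation for convex sets, norming functionals *)

Section HahnBanachConsequences.
Context (R : realType) (X : normedModType R).

(** Reduces to the cone version: the cone [K] generated by [S] still has a nonnegative fibre over
    0. *)
Lemma hahn_banach_convex (S : set (X * R)) (r M : R) :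
  (forall u v s t a b, S (u, s) -> S (v, t) -> 0 < a -> 0 < b -> a + b = 1 ->
    S (a *: u + b *: v, a * s + b * t)) ->
  nonneg_fiber S -> 0 < r -> (forall v, `|v| <= r -> S (v, M)) ->
  exists f : dual X, forall v t, S (v, t) -> ⟨v, f⟩ <= t.
Proof.
move=> Sc Sn r0 SM.
pose K : set (X * R) := [set p | exists2 c, 0 < c & S (c *: p.1, c * p.2)].
have SK p : S p -> K p.
  by case: p => u s Su; exists 1; rewrite //= scale1r mul1r.
have [] := @hahn_banach_cone _ _ K r M.
- move=> u v s t a b [c c0 /= Sv] [d d0 /= Sw] a0 b0.
  have ac0 : 0 < a / c by rewrite divr_gt0.
  have bd0 : 0 < b / d by rewrite divr_gt0.
  (* Normalises the two weights to sum 1, so that convexity of [S] applies. *)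
  pose e := (a / c + b / d)^-1.
  have e0 : 0 < e by rewrite invr_gt0 addr_gt0.
  exists e => //=.
  have := Sc _ _ _ _ (e * (a / c)) (e * (b / d)) Sv Sw.
  have ec : e * (a / c) * c = e * a by rewrite -mulrA divfK ?gt_eqF.
  have ed : e * (b / d) * d = e * b by rewrite -mulrA divfK ?gt_eqF.
  have abe : e * (a / c) + e * (b / d) = 1.
    by rewrite -mulrDr mulVf// gt_eqF// addr_gt0.
  move=> /(_ (mulr_gt0 e0 ac0) (mulr_gt0 e0 bd0) abe).
  by rewrite !scalerA !(mulrA _ c) !(mulrA _ d) ec ed scalerDr !scalerA mulrDr !mulrA.
- by move=> t [c c0 /=]; rewrite scaler0 => /Sn; rewrite pmulr_rge0.
- exact: r0.
- by move=> v vr; apply: SK; exact: SM.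
by move=> f fK; exists f => v t /SK; exact: fK.
Qed.

(** [K] is the cone spanned by the epigraph of [N] times the norm and the point
    [(- d, - (N * |d|))]: the epigraph yields the upper bound, the extra point the norming
    inequality. *)
Lemma norming_functional (d : X) (N : R) : 0 <= N ->
  exists2 f : dual X, N * `|d| <= ⟨d, f⟩ & forall v, ⟨v, f⟩ <= N * `|v|.
Proof.
move=> N0.
pose K : set (X * R) :=
  [set p | exists2 r, 0 <= r & N * `|p.1 + r *: d| - r * (N * `|d|) <= p.2].
have [] := @hahn_banach_cone _ _ K 1 N.
- move=> u v s t a b [c c0 /= hu] [e e0 /= hv] a0 b0.
  exists (a * c + b * e); first by rewrite addr_ge0// mulr_ge0// ltW.
  rewrite /= scalerDl -!scalerA addrACA -!scalerDr.
  have := ler_normD (a *: (u + c *: d)) (b *: (v + e *: d)).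
  rewrite !normrZ !gtr0_norm// => /(ler_wpM2l N0) h.
  have := ler_wpM2l (ltW a0) hu; have := ler_wpM2l (ltW b0) hv; lra.
- move=> t [c c0 /=]; rewrite add0r normrZ ger0_norm//.
  by rewrite mulrCA subrr.
- exact: ltr01.
- move=> v v1; exists 0 => //=; rewrite scale0r addr0 mul0r subr0.
  by rewrite -[leRHS]mulr1; exact: ler_wpM2l.
move=> f fK; exists f.
  have : K (- d, - (N * `|d|)) by exists 1; rewrite //= scale1r addNr normr0 mulr0 mul1r sub0r.
  by move=> /fK; rewrite pairingNl lerN2.
by move=> v; apply: fK; exists 0; rewrite //= scale0r addr0 mul0r subr0.
Qed.

Lemma pairing_le_norm (f : dual X) (r Q : R) : 0 < r ->
  (forall h, `|h| <= r -> ⟨h, f⟩ <= Q) -> forall v, ⟨v, f⟩ <= Q / r * `|v|.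
Proof.
move=> r0 fQ v; have [->|v0] := eqVneq v 0.
  by rewrite pairingE normr0 mulr0.
have v0' : 0 < `|v| by rewrite normr_gt0.
have k0 : 0 < r / `|v| by rewrite divr_gt0.
have := fQ ((r / `|v|) *: v).
rewrite normrZ (gtr0_norm k0) divfK ?gt_eqF// lexx => /(_ isT).
rewrite pairingZl mulrAC ler_pdivrMr// => h.
by rewrite mulrAC ler_pdivlMr// mulrC.
Qed.

End HahnBanachConsequences.

(** * Monotone operators: maximality as a membership test *)

Section Monotone.
Context (R : realType) (X : normedModType R).
Implicit Types (A B : X -> set (dual X)).

Lemma monotone_pairing A x y a b : monotone_op A -> A x a -> A y b ->
  0 <= ⟨x - y, a - b⟩.
Proof. by move=> mA Ax Ay; exact: (mA (x, a) (y, b)). Qed.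

Lemma maximal_monotone_in A x a : maximal_monotone A ->
  (forall y b, A y b -> 0 <= ⟨x - y, a - b⟩) -> A x a.
Proof.
move=> [mA maxA] h; apply: contrapT => nAx; apply: maxA.
exists (fun y => A y `|` [set b | y = x /\ b = a]); split; last first.
  split; first by move=> p Ap; left.
  by move=> /(_ (x, a)) /=; apply: contra_not nAx => /(_ (or_intror (conj erefl erefl))).
have mA' y b : A y b -> 0 <= ⟨y - x, b - a⟩.
  move=> /h; rewrite !pairingE; lra.
move=> [y b] [y' b']; rewrite /gra /= => -[Ay|[-> ->]] [Ay'|[-> ->]].
- exact: (mA (y, b) (y', b')).
- exact: (mA' _ _ Ay).
- exact: (h _ _ Ay').
- by rewrite -[X in _ <= X]/(⟨x - x, a - a⟩) subrr pairing0l.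
Qed.

(** One-sided on purpose: replacing [v] by [- v] turns it into a bound [M] on the norm of [b]. *)
Definition bounded_around B z (r M : R) :=
  forall y b, `|y - z| < r -> B y b -> forall v, ⟨v, b⟩ <= M * `|v|.

End Monotone.

(** * Local boundedness in the interior of the domain *)

Section LocalBoundedness.
Context (R : realType) (X : completeNormedModType R) (B : X -> set (dual X)).
Hypothesis mB : monotone_op B.

(** Monotonicity is tested against a graph point over [x0 + u]. The factor [1 + |⟨y - x0, b⟩|] is
    the one divided out before applying Banach-Steinhaus. *)
Lemma monotone_pointwise_bound x0 (e : R) (u : X) :
  (forall y, `|y - x0| < e -> dom B y) -> `|u| < e ->
  exists2 K, 0 <= K & forall y b, B y b -> `|y - x0| <= 1 ->
    ⟨u, b⟩ <= (1 + `|⟨y - x0, b⟩|) * K.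
Proof.
move=> eB ue; have [|xs Bxs] := eB (x0 + u); first by rewrite addrAC subrr add0r.
have [M M0 Mxs] := dual_bounded xs.
exists (1 + M * (1 + `|u|)).
  by rewrite addr_ge0// mulr_ge0 ?addr_ge0// ltW.
move=> y b By y1; have := monotone_pairing mB By Bxs.
rewrite opprD addrA => h.
have h1 : - ⟨y - x0 - u, xs⟩ <= M * (1 + `|u|).
  apply: (le_trans (ler_norm _)); rewrite normrN; apply: (le_trans (Mxs _)).
  rewrite ler_pM2l//; apply: (le_trans (ler_normB _ _)); lra.
have h2 := ler_norm ⟨y - x0, b⟩.
have h3 := normr_ge0 ⟨y - x0, b⟩.
have h4 : 0 <= `|⟨y - x0, b⟩| * (M * (1 + `|u|)).
  by rewrite mulr_ge0// mulr_ge0 ?addr_ge0// ltW.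
move: h h1 h2 h3 h4; rewrite !pairingE; lra.
Qed.

(** The functionals [b] divided by [c y b] are pointwise bounded, hence uniformly bounded by
    completeness of [X]; close to [x0] the divisor itself is at most 2. *)
Lemma monotone_locally_bounded x0 : interior (dom B) x0 ->
  exists r M, [/\ 0 < r, 0 <= M, forall y, `|y - x0| < r -> dom B y &
    bounded_around B x0 r M].
Proof.
rewrite /interior => /nbhs_ballP [e /= e0 eB'].
have eB y : `|y - x0| < e -> dom B y.
  by move=> ye; apply: eB'; rewrite -ball_normE /= distrC.
pose c (y : X) (b : dual X) : R := 1 + `|⟨y - x0, b⟩|.
have c0 y b : 0 < c y b by rewrite ltr_pwDl.
pose F : set (X -> R^o) := [set h | exists y b, [/\ B y b, `|y - x0| <= 1 &
  h = dual_fun ((c y b)^-1 *: b)]].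
have [|v|M' FM'] := @Banach_Steinhauss _ _ _ F _ _ 1.
- move=> h [y [b [By y1 ->]]]; split; last exact: dual_linear.
  move=> r; have [M M0 Mb] := dual_bounded ((c y b)^-1 *: b).
  by exists (M * r) => x xr; apply: (le_trans (Mb x)); rewrite ler_pM2l.
(* Shrinks [v] so that both [k *: v] and its opposite are admissible directions, giving a two-sided
   bound. *)
- pose k := e / 2 / (`|v| + 1).
  have k0 : 0 < k by rewrite !divr_gt0// ltr_wpDl.
  have kv : `|k *: v| < e.
    rewrite normrZ gtr0_norm// /k mulrAC ltr_pdivrMr ?ltr_wpDl//.
    by have := normr_ge0 v; nra.
  have [K K0 hK] := monotone_pointwise_bound eB kv.
  have [|K' K'0 hK'] := @monotone_pointwise_bound x0 e (- (k *: v)) eB.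
    by rewrite normrN.
  exists ((K + K') / k) => h [y [b [By y1 ->]]].
  rewrite -[X in `|X|]/(⟨v, (c y b)^-1 *: b⟩) pairingZr.
  rewrite normrM gtr0_norm ?invr_gt0// ler_pdivrMl// mulrA ler_pdivlMr//.
  have := hK _ _ By y1; have := hK' _ _ By y1; rewrite -/(c y b) !pairingE => h1 h2.
  rewrite -[X in _ * X](gtr0_norm k0) -normrM ler_norml (mulrDr (c y b)).
  have := mulr_ge0 (ltW (c0 y b)) K0; have := mulr_ge0 (ltW (c0 y b)) K'0.
  by move=> h3 h4; apply/andP; split; lra.
pose M := `|M'| + 1.
have M0 : 0 < M by rewrite ltr_wpDl.
have FM y b v : B y b -> `|y - x0| <= 1 -> `|v| <= 1 -> `|⟨v, b⟩| <= M * c y b.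
  move=> By y1 v1; rewrite -ler_pdivrMr// mulrC.
  rewrite -[X in X * _]gtr0_norm ?invr_gt0// -normrM -pairingZr.
  apply: (@le_trans _ _ M'); first by apply: FM' => //; exists y, b.
  by apply: (le_trans (ler_norm _)); rewrite lerDl.
pose r := Num.min e (Num.min 1 (2 * M)^-1).
exists r, (2 * M / 1); split.
- by rewrite !lt_min e0 ltr01 invr_gt0 mulr_gt0.
- by rewrite divr_ge0// mulr_ge0// ltW.
- by move=> y; rewrite lt_min => /andP[ye _]; exact: eB.
move=> y b; rewrite !lt_min => /and3P[ye y1 yM] By.
apply: pairing_le_norm => // h h1; apply: (le_trans (ler_norm _)).
apply: (le_trans (FM _ _ _ By (ltW y1) h1)).
rewrite mulrC ler_pM2r//.
(* This vector has norm at most 1, so [|⟨y - x0, b⟩|] is at most half of [c y b], whence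
   [c y b <= 2]. *)
have := FM _ _ ((2 * M) *: (y - x0)) By (ltW y1).
rewrite normrZ gtr0_norm ?mulr_gt0// -ler_pdivlMl ?mulr_gt0// mulr1 ltW// => /(_ isT).
rewrite pairingZl normrM gtr0_norm ?mulr_gt0// (mulrC 2) -mulrA ler_pM2l//.
rewrite /c; lra.
Qed.

End LocalBoundedness.

(** * Open convex neighbourhoods of segments *)

Section Tube.
Context (R : realType) (X : normedModType R).
Implicit Types (z d x : X) (e : R).

Definition tube z d e : set X :=
  [set x | exists2 s, 0 <= s <= 1 & `|x - (z + s *: d)| < e].

Lemma open_tube z d e : open (tube z d e).
Proof.
rewrite openE => x [s s01 xe]; apply/nbhs_ballP.
exists (e - `|x - (z + s *: d)|) => /=; first by rewrite subr_gt0.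
move=> y; rewrite -ball_normE /= ltrBrDr distrC => yx; exists s => //.
by apply: le_lt_trans yx; apply: ler_distD.
Qed.

Lemma convex_tube z d e : convex_set (tube z d e : set (convex_lmodType X)).
Proof.
move=> x y l /set_mem[s /andP[s0 s1] xs] /set_mem[t /andP[t0 t1] yt]; apply/mem_set.
have [a0 b0] : 0 <= l%:inum :> R /\ 0 <= 1 - l%:inum :> R by rewrite subr_ge0.
rewrite /conv /=; move: (l%:inum) a0 b0 => a a0; set b := 1 - a => b0.
have ab : a + b = 1 by rewrite addrC subrK.
exists (a * s + b * t).
  by apply/andP; split; nra.
suff -> : (a *: (x : X) + b *: (y : X)) - (z + (a * s + b * t) *: d) =
    a *: (x - (z + s *: d)) + b *: (y - (z + t *: d)).
  apply: (le_lt_trans (ler_normD _ _)); rewrite !normrZ !ger0_norm//.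
  (* The case split selects a weight that is certainly positive, to keep the inequality strict. *)
  have [a1|a1] := leP a 2^-1.
    have : b * `|y - (z + t *: d)| < b * e by rewrite ltr_pM2l//; lra.
    have := ler_wpM2l a0 (ltW xs); nra.
  have : a * `|x - (z + s *: d)| < a * e by rewrite ltr_pM2l//; lra.
  have := ler_wpM2l b0 (ltW yt); nra.
rewrite !scalerBr !scalerDr !scalerA addrACA -!opprD addrACA -!scalerDl ab.
by rewrite scale1r.
Qed.

End Tube.

(** * Spreading boundedness from [x0] along segments *)

Section BoundednessPropagation.
Context (R : realType) (X : normedModType R) (B : X -> set (dual X)).
Hypothesis mB : monotone_op B.
Variables (x0 : X) (r K : R).
Hypotheses (r0 : 0 < r) (K0 : 0 <= K) (rB : forall y, `|y - x0| < r -> dom B y)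
  (KB : bounded_around B x0 r K).

(** A point [p] near [z + t *: (x0 - z)] is [t *: v + (1 - t) *: y] with [y] in [dom B] near [z] and
    [v] near [x0]. Weighting monotonicity at [v + h] and at [y] by [t] and [1 - t] leaves only
    [t * ⟨h, ps⟩] to bound. *)
Lemma bounded_around_segment z t : closure (dom B) z -> 0 < t <= 1 ->
  exists r' M, [/\ 0 < r', 0 <= M & bounded_around B (z + t *: (x0 - z)) r' M].
Proof.
move=> zB /andP[t0 t1].
(* Two errors of size [eta], divided by [t], move [v] by at most [r / 4] from [x0]. *)
pose eta := t * r / 8.
have eta0 : 0 < eta by rewrite /eta !mulr_gt0// invr_gt0.
have [y [[ys By] zy]] := zB _ (nbhsx_ballx z eta eta0).
move: zy; rewrite -ball_normE /= => zy.
have [L L0 ysL] := dual_bounded ys.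
set zt := z + t *: (x0 - z).
pose Q := t * (K * (r + `|x0 - zt| + eta)) + (1 - t) * (L * (`|y - zt| + eta)).
have Q0 : 0 <= Q.
  rewrite /Q addr_ge0// mulr_ge0 ?subr_ge0 ?(ltW t0)// mulr_ge0 ?(ltW L0)//.
    by rewrite !addr_ge0// ltW.
  by rewrite addr_ge0// ltW.
exists eta, (Q / t / (r / 4)); split => //.
  by rewrite !divr_ge0// ltW.
move=> p ps pzt Bp; apply: pairing_le_norm; first by rewrite divr_gt0.
move=> h hr; rewrite ler_pdivlMr// mulrC.
pose v := x0 + t^-1 *: (p - zt + (1 - t) *: (z - y)).
have vx0 : `|v - x0| <= r / 4.
  rewrite /v addrAC subrr add0r normrZ gtr0_norm ?invr_gt0// ler_pdivrMl//.
  apply: (le_trans (ler_normD _ _)); rewrite normrZ ger0_norm ?subr_ge0//.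
  have : (1 - t) * `|z - y| <= 1 * eta by rewrite ler_pM ?subr_ge0 ?(ltW zy)//; lra.
  move: pzt; rewrite /eta; lra.
have vh : `|v + h - x0| < r.
  rewrite addrAC; apply: (le_lt_trans (ler_normD _ _)); move: r0; lra.
have [vs Bv] := rB vh.
have h1 := monotone_pairing mB Bv Bp.
have h2 := monotone_pairing mB By Bp.
have h3 : ⟨v + h - p, vs⟩ <= K * (r + `|x0 - zt| + eta).
  apply: (le_trans (KB vh Bv _)); apply: ler_wpM2l => //.
  have := ler_distD x0 (v + h) p; have := ler_distD zt x0 p.
  by rewrite (distrC zt p); lra.
have h4 : ⟨y - p, ys⟩ <= L * (`|y - zt| + eta).
  apply: (le_trans (ler_norm _)); apply: (le_trans (ysL _)).
  rewrite ler_pM2l//; have := ler_distD zt y p; rewrite (distrC zt p); lra.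
have vE : t * ⟨v, ps⟩ = ⟨p, ps⟩ - (1 - t) * ⟨y, ps⟩.
  by rewrite /v /zt !pairingE; field; rewrite gt_eqF.
have t1' : 0 <= 1 - t by rewrite subr_ge0.
have := ler_wpM2l (ltW t0) h1; have := ler_wpM2l t1' h2.
have := ler_wpM2l (ltW t0) h3; have := ler_wpM2l t1' h4.
rewrite /Q; clearbody v zt eta; clear Q0 h1 h2 h3 h4.
move: vE; rewrite !pairingE; lra.
Qed.

(** Near [z] the local bound applies. Farther away, [x] lies between [z] and a point [y] of the ball
    around [x0], and monotonicity along this line bounds [b] by a value of [B] at [y]. *)
Lemma tube_bound z (rz Kz : R) : 0 < rz -> 0 <= Kz -> bounded_around B z rz Kz ->
  exists N e, [/\ 0 <= N, 0 < e & forall e' x b, e' <= e -> tube z (x0 - z) e' x ->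
    B x b -> ⟨x - z, b⟩ <= N * `|x - z|].
Proof.
move=> rz0 Kz0 KzB.
pose D := `|x0 - z|.
have D0 : 0 <= D := normr_ge0 _.
pose s0 := rz / (2 * (D + 1)).
have s00 : 0 < s0 by rewrite divr_gt0// mulr_gt0// ltr_wpDl.
pose N := Num.max K Kz.
pose e := Num.min (rz / 2) (Num.min r (s0 * r)).
exists N, e; split.
- by rewrite le_max K0.
- by rewrite !lt_min r0 divr_gt0//= mulr_gt0.
move=> e' x b e'e [s /andP[s0' s1]] xs' Bx.
have xs := lt_le_trans xs' e'e.
move: xs; rewrite !lt_min => /and3P[xs1 xs2 xs3].
have [xz|xz] := ltP `|x - z| rz.
  apply: (le_trans (KzB _ _ xz Bx _)); apply: ler_wpM2r => //.
  by rewrite le_max lexx orbT.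
(* Since [x] is at least [rz] from [z] but within [rz / 2] of the segment, its parameter stays away
   from 0; the [D + 1] in [s0] covers [x0 = z]. *)
have ss0 : s0 <= s.
  rewrite /s0 ler_pdivrMr ?mulr_gt0// ?ltr_wpDl//.
  have := ler_normD (x - (z + s *: (x0 - z))) (s *: (x0 - z)).
  rewrite opprD addrA subrK normrZ ger0_norm// -/D.
  move: xs1; rewrite opprD addrA; nra.
have sp : 0 < s by exact: lt_le_trans ss0.
pose y := x0 + s^-1 *: (x - (z + s *: (x0 - z))).
have xzE : x - z = s *: (y - z).
  rewrite /y; set w := s *: (x0 - z).
  rewrite addrAC scalerDr scalerA mulfV ?gt_eqF// scale1r -/w.
  by rewrite [w + _]addrC opprD addrA subrK.
have yxE : y - x = (1 - s) *: (y - z).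
  by rewrite scalerBl scale1r -xzE opprB addrA subrK.
have yr : `|y - x0| < r.
  rewrite /y addrAC subrr add0r normrZ gtr0_norm ?invr_gt0// ltr_pdivrMl//.
  by apply: (lt_le_trans xs3); rewrite ler_pM2r.
have [s1'|s1'] := eqVneq s 1.
  have -> : x = y by apply/eqP; rewrite eq_sym -subr_eq0 yxE s1' subrr scale0r.
  have : B y b by have /eqP := yxE; rewrite s1' subrr scale0r subr_eq0 => /eqP ->.
  move=> By; apply: (le_trans (KB yr By _)); apply: ler_wpM2r => //.
  by rewrite le_max lexx.
have [ys By] := rB yr.
have s1l : 0 < 1 - s by rewrite subr_gt0 lt_neqAle s1'.
have := monotone_pairing mB By Bx.
rewrite yxE pairingZl pmulr_rge0// pairingDr pairingNr subr_ge0 => yb.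
rewrite xzE pairingZl normrZ gtr0_norm// mulrCA ler_pM2l//.
apply: (le_trans yb); apply: (le_trans (KB yr By _)); apply: ler_wpM2r => //.
by rewrite le_max lexx.
Qed.

End BoundednessPropagation.

(** * Type (FPV) and the Fitzpatrick inequality for [T + B] *)

Section Gap.
Context (R : realType) (X : normedModType R) (T B : X -> set (dual X)).
Hypotheses (fpvT : type_FPV T) (mB : monotone_op B) (domTB : dom T `<=` dom B).
Variables (x0 : X) (r K : R).
Hypotheses (r0 : 0 < r) (K0 : 0 <= K) (rB : forall y, `|y - x0| < r -> dom B y)
  (KB : bounded_around B x0 r K) (Tx0 : dom T x0).

(* If the conclusion failed, tilting [zs] by a functional that norms [z - x0]
   would absorb the contribution of [B] on a thin tube around the segment
   from [z] to [x0], and (FPV) would put [z] in [dom T]. *)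
Lemma FPV_gap_bounded z (rz Kz : R) : 0 < rz -> 0 <= Kz -> bounded_around B z rz Kz ->
  forall zs eps, 0 < eps ->
  exists x a b, [/\ T x a, B x b & ⟨z - x, zs - (a + b)⟩ < eps].
Proof.
move=> rz0 Kz0 KzB zs eps eps0; apply: contrapT => noxab.
have far x a b : T x a -> B x b -> eps <= ⟨z - x, zs - (a + b)⟩.
  by move=> Tx Bx; rewrite leNgt; apply/negP => lt; apply: noxab; exists x, a, b.
have [N [e [N0 e0 tubeN]]] := tube_bound mB r0 K0 rB KB rz0 Kz0 KzB.
pose e' := Num.min e (eps / (2 * (N + 1))).
have e'0 : 0 < e' by rewrite lt_min e0 divr_gt0// mulr_gt0// ltr_wpDl.
have Ne' : 2 * N * e' <= eps.
  have : e' <= eps / (2 * (N + 1)) by rewrite ge_min lexx orbT.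
  rewrite ler_pdivlMr ?mulr_gt0// ?ltr_wpDl//; move: e'0; nra.
have [g zg gN] := norming_functional (z - x0) N0.
have tz : tube z (x0 - z) e' z.
  by exists 0; rewrite ?lexx ?ler01// scale0r addr0 subrr normr0.
have tx0 : tube z (x0 - z) e' x0.
  by exists 1; rewrite ?lexx ?ler01// scale1r [z + _]addrC subrK subrr normr0.
have Tz : gra T (z, zs + g).
  apply: (fpvT.2 _ (@open_tube _ _ z (x0 - z) e') (@convex_tube _ _ z (x0 - z) e')
    (ex_intro _ x0 (conj tx0 Tx0)) z (zs + g) tz) => -[x a] [Tx [tx _]].
  rewrite -[X in _ <= X]/(⟨z - x, zs + g - a⟩).
  have [b Bx] := domTB (ex_intro _ a Tx).
  have h1 := far _ _ _ Tx Bx.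
  have h2 : ⟨x - z, b⟩ <= N * `|x - z|.
    by apply: (tubeN _ _ _ _ tx Bx); rewrite ge_min lexx.
  (* As [x = z + s (x0 - z) + W], the pairing of [z - x] with [g] is at least
     [s N |z - x0| - N |W|]. This offsets the bound [N |x - z|] on [B] up to [2 N |W|], which is at
     most [eps]. *)
  case: tx => s /andP[s0 s1]; set W := x - _ => We.
  have h3 := gN W.
  have h4 : `|x - z| <= `|W| + s * `|z - x0|.
    rewrite -[s in leRHS]ger0_norm// -normrZ.
    apply: le_trans (ler_normB _ _).
    by rewrite /W -(opprB x0 z) scalerN opprK opprD addrA subrK.
  have h5 := ler_wpM2l s0 zg.
  have h6 := ler_wpM2l N0 h4.
  have h7 := ler_wpM2l N0 (ltW We).
  move: h1 h2 h3 h5 h6; rewrite /W !pairingE; lra.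
(* Now [z] itself may serve as [x], and its pairing is 0. *)
have [b Bz] : dom B z by apply: domTB; exists (zs + g).
by have := far z (zs + g) b Tz Bz; rewrite subrr pairing0l leNgt eps0.
Qed.

(** Outside the closure of [dom B], local boundedness is vacuous. Inside, [(z, zs)] is moved
    slightly towards [(x0, a0 + b0)], to a point where [B] is locally bounded. *)
Lemma FPV_gap z zs eps : 0 < eps ->
  exists x a b, [/\ T x a, B x b & ⟨z - x, zs - (a + b)⟩ < eps].
Proof.
move=> eps0; have [zB|] := pselect (closure (dom B) z); last first.
  rewrite /closure /= => /existsNP[V /not_implyP[/nbhs_ballP[e /= e0 eV] BV]].
  apply: (@FPV_gap_bounded z e 0) => // y b ye By.
  exfalso; apply: BV; exists y; split; first by exists b.
  by apply: eV; rewrite -ball_normE /= distrC.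
apply: contrapT => noxab.
have far x a b : T x a -> B x b -> eps <= ⟨z - x, zs - (a + b)⟩.
  by move=> Tx Bx; rewrite leNgt; apply/negP => lt; apply: noxab; exists x, a, b.
have [a0 Ta0] := Tx0; have [b0 Bb0] := domTB Tx0.
pose c := ⟨x0 - z, a0 + b0 - zs⟩.
(* Small enough for [t * c <= eps / 2] and [t <= 1 / 2]. *)
pose t := eps / (2 * (`|c| + eps)).
have ce : 0 < `|c| + eps by rewrite ltr_wpDl.
have t0 : 0 < t by rewrite divr_gt0// mulr_gt0.
have tE : t * (2 * (`|c| + eps)) = eps by rewrite divfK// gt_eqF// mulr_gt0.
have t1 : t <= 1 / 2.
  by rewrite ler_pdivrMr ?mulr_gt0// mulrA divrK ?unitfE// mul1r lerDr.
have tc : t * c <= eps / 2.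
  have : t * c <= t * `|c| by rewrite ler_pM2l// ler_norm.
  have := mulr_gt0 t0 eps0; lra.
have [|r' [M [r'0 M0 MB]]] := bounded_around_segment mB r0 K0 rB KB zB (t := t).
  by rewrite t0; lra.
have eps4 : 0 < eps / 4 by rewrite divr_gt0.
have [x [a [b [Tx Bx]]]] :=
  FPV_gap_bounded r'0 M0 MB (zs + t *: (a0 + b0 - zs)) eps4.
have h1 := far _ _ _ Tx Bx.
have h2 := monotone_pairing fpvT.1.1 Ta0 Tx.
have h3 := monotone_pairing mB Bb0 Bx.
(* The pairing is quadratic, so along the segment it is the interpolation of its end values minus
   [t (1 - t) c]. *)
set L := ⟨_, _⟩; have -> : L = (1 - t) * ⟨z - x, zs - (a + b)⟩ +
    t * (⟨x0 - x, a0 - a⟩ + ⟨x0 - x, b0 - b⟩) - (1 - t) * (t * c).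
  by rewrite /L /c !pairingE; ring.
have := mulr_ge0 (ltW t0) (addr_ge0 h2 h3).
have : (1 - t) * (eps / 2) <= (1 - t) * (⟨z - x, zs - (a + b)⟩ - t * c).
  by apply: ler_wpM2l; lra.
have : eps / 4 <= (1 - t) * (eps / 2).
  have : 1 / 2 * (eps / 2) <= (1 - t) * (eps / 2) by apply: ler_wpM2r; lra.
  lra.
lra.
Qed.

End Gap.

(** * Maximality of the sum by separation *)

Section SumMaximality.
Context (R : realType) (X : normedModType R) (A B : X -> set (dual X)).
Hypotheses (maxA : maximal_monotone A) (maxB : maximal_monotone B).

Lemma monotone_sum : monotone_op (sum_op A B).
Proof.
move=> [x xs] [y ys]; rewrite /gra /= => -[a Ax [b Bx <-]] [a' Ay [b' By <-]].
rewrite -[X in _ <= X]/(⟨x - y, a + b - (a' + b')⟩).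
have := monotone_pairing maxA.1 Ax Ay; have := monotone_pairing maxB.1 Bx By.
rewrite !pairingE; lra.
Qed.

Variables (x0 : X) (r K : R).
Hypotheses (r0 : 0 < r) (K0 : 0 <= K) (rB : forall y, `|y - x0| < r -> dom B y)
  (KB : bounded_around B x0 r K) (Ax0 : dom A x0)
  (gap : forall z zs eps, 0 < eps ->
    exists x a b, [/\ A x a, B x b & ⟨z - x, zs - (a + b)⟩ < eps]).

Section Splitting.
Variables (z : X) (zs : dual X).
Hypothesis rel : forall x a b, A x a -> B x b -> 0 <= ⟨z - x, zs - (a + b)⟩.

(* Sublevel conditions of the Fitzpatrick functions of [A] and of [B - zs],
   recentred at [z]; they make the set to be separated convex. *)
Let EA x a t := forall u us, A u us -> ⟨x, us⟩ + ⟨u, a⟩ - ⟨u, us⟩ <= t + ⟨z, a⟩.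
Let EB y b t := forall u us, B u us ->
  ⟨y, us⟩ + ⟨u, b⟩ - ⟨u, us⟩ <= t + ⟨z, b⟩ + ⟨y - z, zs⟩.
Let S : set (X * R) := [set p | exists x y s t a b,
  [/\ p.1 = x - y, p.2 = s + t, EA x a s & EB y b t]].

Let S_convex u v s t a b : S (u, s) -> S (v, t) -> 0 < a -> 0 < b -> a + b = 1 ->
  S (a *: u + b *: v, a * s + b * t).
Proof.
move=> [x [y [s1 [t1 [f [g [/= -> -> Ef Eg]]]]]]].
move=> [x' [y' [s1' [t1' [f' [g' [/= -> -> Ef' Eg']]]]]]] a0 b0 ab.
exists (a *: x + b *: x'), (a *: y + b *: y'), (a * s1 + b * s1'), (a * t1 + b * t1').
exists (a *: f + b *: f'), (a *: g + b *: g').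
have bE : b = 1 - a by lra.
split => /=.
- by rewrite !scalerBr opprD addrACA.
- by ring.
- move=> w ws Aw; have := ler_wpM2l (ltW a0) (Ef _ _ Aw).
  have := ler_wpM2l (ltW b0) (Ef' _ _ Aw); rewrite bE !pairingE; lra.
- move=> w ws Bw; have := ler_wpM2l (ltW a0) (Eg _ _ Bw).
  have := ler_wpM2l (ltW b0) (Eg' _ _ Bw); rewrite bE !pairingE; lra.
Qed.

(** If [t < 0], a short step [l] from [(z, zs)] towards [(x, f + g)] gives a pair whose pairing with
    every graph point of the sum is at least [l * (- t / 2)], against [gap]. *)
Let S_nonneg : nonneg_fiber S.
Proof.
move=> t [x [y [s1 [t1 [f [g [/= /esym/eqP]]]]]]].
rewrite subr_eq0 => /eqP <- tE Ef Eg; rewrite leNgt; apply/negP => t0.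
pose c := ⟨x - z, f + g - zs⟩.
(* Keeps the second-order term [l * c] below [- t / 2] in absolute value, with [l <= 1]. *)
pose l := - t / (2 * (`|c| - t)).
have ct : 0 < `|c| - t by rewrite ltr_wpDl// oppr_gt0.
have l0 : 0 < l by rewrite divr_gt0 ?oppr_gt0// mulr_gt0.
have lE : l * (2 * (`|c| - t)) = - t by rewrite divfK// gt_eqF// mulr_gt0.
have l1 : l <= 1.
  by rewrite ler_pdivrMr ?mulr_gt0//; have := normr_ge0 c; lra.
have lc : - (l * c) <= - t / 2.
  have : l * (- c) <= l * `|c| by rewrite ler_pM2l// -normrN ler_norm.
  have : 0 < l * (- t) by rewrite mulr_gt0 ?oppr_gt0.
  lra.
have [|u [a [b [Au Bu]]]] := gap (z + l *: (x - z)) (zs + l *: (f + g - zs)) (eps := l * (- t / 2)).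
  by rewrite mulr_gt0// divr_gt0 ?oppr_gt0.
set L := ⟨_, _⟩.
have h0 := rel Au Bu; have h1 := Ef _ _ Au; have h2 := Eg _ _ Bu.
pose q := ⟨z - u, zs - (a + b)⟩.
pose m := ⟨x - z, zs - (a + b)⟩ + ⟨z - u, f + g - zs⟩.
have -> : L = q + l * m + l * (l * c).
  by rewrite /L /q /m /c !pairingE; ring.
have : - t <= m + q.
  by move: h1 h2; rewrite tE /m /q !pairingE; lra.
move=> /(ler_wpM2l (ltW l0)).
have : l * q <= 1 * q by apply: ler_wpM2r.
have := ler_wpM2l (ltW l0) lc.
lra.
Qed.

(** Fixing [x0] for [A] and letting [x0 - v] vary for [B] covers a ball of differences; local
    boundedness of [B] makes the height uniform. *)
Let S_ball : exists M, forall v, `|v| <= r / 2 -> S (v, M).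
Proof.
have [a0 Aa0] := Ax0; have [L L0 zsL] := dual_bounded zs.
exists (⟨x0 - z, a0⟩ + (K + L) * (`|x0 - z| + r / 2)) => v vr.
have [|b Bb] := @rB (x0 - v).
  rewrite addrAC subrr add0r normrN; apply: le_lt_trans vr _.
  by move: r0; lra.
exists x0, (x0 - v), ⟨x0 - z, a0⟩, ((K + L) * (`|x0 - z| + r / 2)), a0, b.
split => //=.
- by rewrite opprB addrC subrK.
- move=> u us Au; have := monotone_pairing maxA.1 Aa0 Au.
  by rewrite !pairingE; lra.
- move=> u us Bu; have := monotone_pairing maxB.1 Bb Bu.
  have vz : `|x0 - v - z| <= `|x0 - z| + r / 2.
    by rewrite addrAC; apply: (le_trans (ler_normB _ _)); lra.
  have h1 : ⟨x0 - v - z, b⟩ <= K * (`|x0 - z| + r / 2).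
    apply: le_trans (ler_wpM2l K0 vz); apply: (KB _ Bb).
    rewrite addrAC subrr add0r normrN; apply: le_lt_trans vr _.
    by move: r0; lra.
  have h2 : - ⟨x0 - v - z, zs⟩ <= L * (`|x0 - z| + r / 2).
    apply: le_trans (ler_wpM2l (ltW L0) vz).
    by apply: (le_trans (ler_norm _)); rewrite normrN.
  by move: h1 h2; rewrite !pairingE; lra.
Qed.

(** Monotonicity puts every pair of graph points of [A] and [B] into [S], so the separating [f]
    makes a sum of two pairings nonnegative; maximality then separates the two terms. *)
Lemma sum_splitting : sum_op A B z zs.
Proof.
have [M SM] := S_ball.
have r20 : 0 < r / 2 by rewrite divr_gt0.
have [f fS] := hahn_banach_convex S_convex S_nonneg r20 SM.
have fAB x a y b : A x a -> B y b -> 0 <= ⟨z - x, f - a⟩ + ⟨z - y, zs - f - b⟩.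
  move=> Ax By.
  have : S (x - y, ⟨x - z, a⟩ + ⟨y - z, b - zs⟩).
    exists x, y, ⟨x - z, a⟩, ⟨y - z, b - zs⟩, a, b; split => //.
      move=> u us Au; have := monotone_pairing maxA.1 Ax Au.
      by rewrite !pairingE; lra.
    move=> u us Bu; have := monotone_pairing maxB.1 By Bu.
    by rewrite !pairingE; lra.
  by move=> /fS; rewrite !pairingE; lra.
have Azf : A z f.
  apply: (maximal_monotone_in maxA) => x a Ax.
  (* A negative [A]-term makes all [B]-terms positive; then [zs - f] lies in [B z], where the
     [B]-term is 0. *)
  rewrite leNgt; apply/negP => lt0.
  have gt0 y b : B y b -> 0 < ⟨z - y, zs - f - b⟩.
    by move=> By; have := fAB _ _ _ _ Ax By; lra.
  have /gt0 : B z (zs - f).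
    by apply: (maximal_monotone_in maxB) => y b /gt0 /ltW.
  by rewrite subrr pairing0l ltxx.
have Bzf : B z (zs - f).
  apply: (maximal_monotone_in maxB) => y b By.
  by have := fAB _ _ _ _ Azf By; rewrite subrr pairing0l add0r.
by exists f => //; exists (zs - f) => //; rewrite addrC subrK.
Qed.

End Splitting.

Lemma maximal_monotone_sum : maximal_monotone (sum_op A B).
Proof.
split; first exact: monotone_sum.
move=> [D [mD [sumD Dsum]]]; apply: Dsum => -[z zs] Dz.
apply: sum_splitting => x a b Ax Bx.
apply: (mD (z, zs) (x, a + b)) => //.
by apply: sumD; exists a => //; exists b.
Qed.

End SumMaximality.

(** * Absorption of the normal cone *)

Section NormalCone.
Context (R : realType) (X : normedModType R).
Implicit Types (C : set X).

Lemma normal_cone_pairing_le0 C x n c : normal_cone C x n -> C c -> ⟨c - x, n⟩ <= 0.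
Proof.
move=> [_ nsup] Cc; rewrite -lee_fin; apply: le_trans nsup.
by apply: ereal_sup_ubound; exists c.
Qed.

Lemma normal_cone0 C x : C x -> normal_cone C x 0.
Proof. by move=> Cx; split => //; apply: ge_ereal_sup => _ [c _ <-]. Qed.

(** For [y] in [dom B] the pairing of [x - y] with [n] is nonnegative, so adding [n] preserves the
    monotonicity test. *)
Lemma maximal_monotone_absorbs_normal_cone (B : X -> set (dual X)) x n b :
  maximal_monotone B -> normal_cone (closure (dom B)) x n -> B x b -> B x (n + b).
Proof.
move=> maxB nx Bx; apply: (maximal_monotone_in maxB) => y c By.
have yB : closure (dom B) y by apply: subset_closure; exists c.
have := normal_cone_pairing_le0 nx yB; have := monotone_pairing maxB.1 Bx By.
by rewrite !pairingE; lra.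
Qed.

End NormalCone.

Theorem theorem3p4 (R : realType) (X : completeNormedModType R)
    (A B : X -> set (dual X)) :
  maximal_monotone A ->
  maximal_monotone B ->
  dom A `&` interior (dom B) !=set0 ->
  type_FPV (sum_op A (normal_cone (closure (dom B)))) ->
  dom A `&` closure (dom B) `<=` dom B ->
  maximal_monotone (sum_op A B).
Proof.
move=> maxA maxB [x0 [Ax0 Bx0]] fpv domAB.
have [r [K [r0 K0 rB KB]]] := monotone_locally_bounded maxB.1 Bx0.
have domTB : dom (sum_op A (normal_cone (closure (dom B)))) `<=` dom B.
  move=> x [_ [a Ax [n nx _]]]; apply: domAB; split; first by exists a.
  exact: nx.1.
have Tx0 : dom (sum_op A (normal_cone (closure (dom B)))) x0.
  have [a Aa] := Ax0; exists (a + 0); exists a => //; exists 0 => //.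
  by apply: normal_cone0; apply: subset_closure; exact: interior_subset Bx0.
apply: (maximal_monotone_sum maxA maxB r0 K0 rB KB Ax0) => z zs eps eps0.
have [x [_ [b [[a Ax [n nx <-]] Bx lt]]]] :=
  FPV_gap fpv maxB.1 domTB r0 K0 rB KB Tx0 z zs eps0.
(* The normal vector is regrouped from the [A] side to the [B] side, where it is absorbed. *)
exists x, a, (n + b); split => //; last by rewrite addrA.
exact: maximal_monotone_absorbs_normal_cone.
Qed.
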